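(* For every integer $N \geq 1$, the following relation holds in the Hecke algebra $H_{N+1}(q)$: $$(\mathsf P_{N} - \mathsf P_{N}')^3 = \frac{[N-1]\,[N+1]}{[N]^2}\,(\mathsf P_{N} - \mathsf P_{N}').$$
   Context: The Hecke algebra $H_N(q)$ is the unital associative algebra over $\mathbb C(q)$ ($q$ an indeterminate) with generators $\mathsf R_1,\ldots,\mathsf R_{N-1}$ and relations $\mathsf R_k^2 = \mathsf 1 + (q-q^{-1})\mathsf R_k$ for $1\le k\le N-1$; $\mathsf R_k \mathsf R_m \mathsf R_k = \mathsf R_m \mathsf R_k \mathsf R_m$ for $|k-m|=1$; $\mathsf R_k \mathsf R_m = \mathsf R_m \mathsf R_k$ for $|k-m|\ge 2$. (So $H_1(q)=\mathbb C(q)$.) Elements of $H_N(q)$ are regarded as elements of $H_{N+1}(q)$ via $\mathsf R_k\mapsto \mathsf R_k$. For $k\in\mathbb Z$, $[k] = \frac{q^k-q^{-k}}{q-q^{-1}}$. The $q$-antisymmetrizer $\mathsf P_N\in H_N(q)$ is defined recursively by $\mathsf P_1=\mathsf 1$ and $$\mathsf P_{N+1} = \frac{1}{[N+1]}\,\mathsf P_N\bigl(q^N - [N]\,\mathsf R_N\bigr)\mathsf P_N .$$ $\mathsf P'_N\in H_{N+1}(q)$ denotes the image of $\mathsf P_N$ under the shift of generators, i.e. under the algebra homomorphism $H_N(q)\to H_{N+1}(q)$, $\mathsf R_k\mapsto \mathsf R_{k+1}$, $k=1,\ldots,N-1$. *)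

(* Defs.v *)
From HB Require Import structures.
From mathcomp Require Import all_boot all_order all_algebra generic_quotient.
From mathcomp Require Import boolp reals.
From mathcomp.real_closed Require Import complex.
From mathcomp.multinomials Require Import monalg.

Set Implicit Arguments.
Unset Strict Implicit.
Unset Printing Implicit Defensive.

Import GRing.Theory.
Local Open Scope ring_scope.
Local Open Scope quotient_scope.

Lemma free_malgC_comm (F : fieldType) (I : choiceType) (c : F)
  (x : {malg F[{fmonom I}]}) : x * c%:MP = c *: x.
Proof.
rewrite -mul_malgC {1 2}(monalgE x) mulr_suml mulr_sumr.
apply: eq_bigr => m _.
have fgUU := @fgmulUU {fmonom I} F.
by rewrite [LHS]fgUU [RHS]fgUU mulm1 mul1m mulrC.
Qed.

Lemma free_scalerAr (F : fieldType) (I : choiceType) (c : F)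
  (x y : {malg F[{fmonom I}]}) : c *: (x * y) = x * (c *: y).
Proof.
transitivity ((x * c%:MP) * y); first by rewrite free_malgC_comm fgscaleAl.
by rewrite -[LHS](mulrA x) mul_malgC.
Qed.

(* A separate constant, because the library declares the algebra structure of
   {malg F[K]} only for commutative monoids K. *)
Definition free_alg (F : fieldType) (I : choiceType) : Type :=
  {malg F[{fmonom I}]}.

HB.instance Definition _ (F : fieldType) (I : choiceType) :=
  GRing.Lalgebra.on (free_alg F I).
HB.instance Definition _ (F : fieldType) (I : choiceType) :=
  GRing.Lalgebra_isAlgebra.Build F (free_alg F I) (@free_scalerAr F I).

(* Locked, so that unification does not unfold it down to finitely supported
   functions. *)
HB.lock Definition free_gen (F : fieldType) (I : choiceType) (i : I) :
  free_alg F I := << fmu i >>.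

Section FreeEval.
Variables (F : fieldType) (I : choiceType) (A : algType F) (r : I -> A).

Definition word_eval (m : {fmonom I}) : A := \prod_(i <- (m : seq I)) r i.

Lemma word_evalM : mmorphism word_eval.
Proof.
by split=> [m1 m2|]; rewrite /word_eval ?fmM ?fm1 ?big_cat ?big_nil.
Qed.

HB.instance Definition _ :=
  monalg.isMultiplicative.Build {fmonom I} A word_eval word_evalM.

Definition free_eval (x : free_alg F I) : A := mmap (in_alg A) word_eval x.

Lemma free_eval_zmod : zmod_morphism free_eval.
Proof. exact: mmapB. Qed.

Lemma free_eval_monoid : monoid_morphism free_eval.
Proof.
split; first exact: mmap1.
move=> x y; apply: (commr_mmap_is_multiplicative _).1 => g m m'.
by rewrite /GRing.comm /= mulr_algl mulr_algr.
Qed.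

Lemma free_eval_scalable : scalable free_eval.
Proof. by move=> c x; rewrite /free_eval mmapZ /= mulr_algl. Qed.

HB.instance Definition _ :=
  GRing.isZmodMorphism.Build (free_alg F I) A free_eval free_eval_zmod.
HB.instance Definition _ :=
  GRing.isMonoidMorphism.Build (free_alg F I) A free_eval free_eval_monoid.
HB.instance Definition _ :=
  GRing.isScalable.Build F (free_alg F I) A *:%R free_eval free_eval_scalable.

Lemma free_eval_gen i : free_eval (free_gen F i) = r i.
Proof.
by rewrite /free_eval unlock mmapU /= scale1r mul1r /word_eval fmU big_seq1.
Qed.

End FreeEval.

(* Quotient of an algebra by the two-sided ideal generated by P.  It may be the
   zero ring, hence is not declared as an algType in general. *)

Section IdealQuotient.
Variables (F : fieldType) (A : algType F) (P : A -> Prop).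

Inductive ideal_gen : A -> Prop :=
| ideal_gen_in x : P x -> ideal_gen x
| ideal_gen0 : ideal_gen 0
| ideal_genD x y : ideal_gen x -> ideal_gen y -> ideal_gen (x + y)
| ideal_genMl a x : ideal_gen x -> ideal_gen (a * x)
| ideal_genMr x a : ideal_gen x -> ideal_gen (x * a).

Lemma ideal_genN x : ideal_gen x -> ideal_gen (- x).
Proof. by rewrite -mulN1r; apply: ideal_genMl. Qed.

Lemma ideal_genZ c x : ideal_gen x -> ideal_gen (c *: x).
Proof. by rewrite -mulr_algl; apply: ideal_genMl. Qed.

Definition ideal_eqv : rel A := fun x y => `[< ideal_gen (x - y) >].

Lemma ideal_eqv_equiv : equiv_class_of ideal_eqv.
Proof.
have sym x y : ideal_eqv x y -> ideal_eqv y x.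
  by move=> /asboolP /ideal_genN; rewrite opprB => ?; apply/asboolP.
split=> [x|x y|y x z].
- by apply/asboolP; rewrite subrr; apply: ideal_gen0.
- by apply/idP/idP; apply: sym.
- move=> /asboolP xy /asboolP yz; apply/asboolP.
  by have := ideal_genD xy yz; rewrite addrA subrK.
Qed.

Canonical ideal_eqv_equivRel := EquivRelPack ideal_eqv_equiv.

Definition ideal_quot : Type := {eq_quot ideal_eqv}.

HB.instance Definition _ : EqQuotient A ideal_eqv ideal_quot :=
  EqQuotient.on ideal_quot.
HB.instance Definition _ := Choice.on ideal_quot.

Local Notation Q := ideal_quot.
Implicit Types (x y : A) (u v w : Q) (a b c : F).

Lemma iq_ind (K : Q -> Prop) : (forall x, K (\pi_Q x)) -> forall u, K u.
Proof. by move=> K_pi u; rewrite -[u]reprK; apply: K_pi. Qed.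

Lemma iq_piP x y : reflect (ideal_gen (x - y)) (\pi_Q x == \pi_Q y).
Proof. by rewrite piE; apply: asboolP. Qed.

Lemma iq_pi_eq x y : ideal_gen (x - y) -> \pi_Q x = \pi_Q y.
Proof. by move/iq_piP/eqP. Qed.

Lemma iq_reprB x : ideal_gen (repr (\pi_Q x) - x).
Proof. by apply/iq_piP; rewrite reprK. Qed.

Definition iq_zero : Q := \pi_Q 0.
Definition iq_one : Q := \pi_Q 1.
Definition iq_opp u : Q := \pi_Q (- repr u).
Definition iq_add u v : Q := \pi_Q (repr u + repr v).
Definition iq_mul u v : Q := \pi_Q (repr u * repr v).
Definition iq_scale c u : Q := \pi_Q (c *: repr u).

Lemma iq_piN x : iq_opp (\pi_Q x) = \pi_Q (- x).
Proof.
by apply: iq_pi_eq; rewrite -opprD; apply/ideal_genN/iq_reprB.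
Qed.

Lemma iq_piD x y : iq_add (\pi_Q x) (\pi_Q y) = \pi_Q (x + y).
Proof.
apply: iq_pi_eq; rewrite opprD addrACA.
by apply: ideal_genD; apply: iq_reprB.
Qed.

Lemma iq_piM x y : iq_mul (\pi_Q x) (\pi_Q y) = \pi_Q (x * y).
Proof.
apply: iq_pi_eq; set x' := repr _; set y' := repr _.
have -> : x' * y' - x * y = (x' - x) * y' + x * (y' - y).
  by rewrite mulrBl mulrBr addrA subrK.
apply: ideal_genD; first exact/ideal_genMr/iq_reprB.
exact/ideal_genMl/iq_reprB.
Qed.

Lemma iq_piZ c x : iq_scale c (\pi_Q x) = \pi_Q (c *: x).
Proof. by apply: iq_pi_eq; rewrite -scalerBr; apply/ideal_genZ/iq_reprB. Qed.

Local Notation iqE := (iq_piN, iq_piD, iq_piM, iq_piZ).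

Lemma iq_addA : associative iq_add.
Proof. by elim/iq_ind=> ?; elim/iq_ind=> ?; elim/iq_ind=> ?; rewrite !iqE addrA. Qed.
Lemma iq_addC : commutative iq_add.
Proof. by elim/iq_ind=> ?; elim/iq_ind=> ?; rewrite !iqE addrC. Qed.
Lemma iq_add0 : left_id iq_zero iq_add.
Proof. by elim/iq_ind=> ?; rewrite !iqE add0r. Qed.
Lemma iq_addN : left_inverse iq_zero iq_opp iq_add.
Proof. by elim/iq_ind=> ?; rewrite !iqE addNr. Qed.

HB.instance Definition _ :=
  GRing.isZmodule.Build Q iq_addA iq_addC iq_add0 iq_addN.

Lemma iq_mulA : associative iq_mul.
Proof. by elim/iq_ind=> ?; elim/iq_ind=> ?; elim/iq_ind=> ?; rewrite !iqE mulrA. Qed.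
Lemma iq_mul1 : left_id iq_one iq_mul.
Proof. by elim/iq_ind=> ?; rewrite !iqE mul1r. Qed.
Lemma iq_mulr1 : right_id iq_one iq_mul.
Proof. by elim/iq_ind=> ?; rewrite !iqE mulr1. Qed.
Lemma iq_mulDl : left_distributive iq_mul iq_add.
Proof. by elim/iq_ind=> ?; elim/iq_ind=> ?; elim/iq_ind=> ?; rewrite !iqE mulrDl. Qed.
Lemma iq_mulDr : right_distributive iq_mul iq_add.
Proof. by elim/iq_ind=> ?; elim/iq_ind=> ?; elim/iq_ind=> ?; rewrite !iqE mulrDr. Qed.

HB.instance Definition _ :=
  GRing.Zmodule_isPzRing.Build Q iq_mulA iq_mul1 iq_mulr1 iq_mulDl iq_mulDr.

Lemma iq_scaleA a b u : iq_scale a (iq_scale b u) = iq_scale (a * b) u.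
Proof. by elim/iq_ind: u => ?; rewrite !iqE scalerA. Qed.
Lemma iq_scale1 : left_id 1 iq_scale.
Proof. by elim/iq_ind=> ?; rewrite !iqE scale1r. Qed.
Lemma iq_scaleDr : right_distributive iq_scale iq_add.
Proof.
by move=> c; elim/iq_ind=> x; elim/iq_ind=> y; rewrite !iqE scalerDr.
Qed.
Lemma iq_scaleDl u a b :
  iq_scale (a + b) u = iq_add (iq_scale a u) (iq_scale b u).
Proof. by elim/iq_ind: u => x; rewrite !iqE scalerDl. Qed.

HB.instance Definition _ := GRing.Zmodule_isLmodule.Build F Q
  iq_scaleA iq_scale1 iq_scaleDr iq_scaleDl.

Lemma iq_scalerAl c u v : c *: (u * v) = (c *: u) * v.
Proof.
elim/iq_ind: u => x; elim/iq_ind: v => y.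
transitivity (\pi_Q (c *: (x * y))); first by rewrite -iq_piZ -iq_piM.
by rewrite scalerAl -iq_piM -iq_piZ.
Qed.

Lemma iq_scalerAr c u v : c *: (u * v) = u * (c *: v).
Proof.
elim/iq_ind: u => x; elim/iq_ind: v => y.
transitivity (\pi_Q (c *: (x * y))); first by rewrite -iq_piZ -iq_piM.
by rewrite scalerAr -iq_piM -iq_piZ.
Qed.

Lemma iq_pi_zmod : zmod_morphism \pi_Q.
Proof. by move=> x y; rewrite -iq_piD -iq_piN. Qed.
Lemma iq_pi_monoid : monoid_morphism \pi_Q.
Proof. by split=> // x y; rewrite -iq_piM. Qed.
Lemma iq_pi_scalable : scalable \pi_Q.
Proof. by move=> c x; rewrite -iq_piZ. Qed.

Lemma ideal_gen_ker (B : algType F) (f : {lrmorphism A -> B}) :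
  (forall x, P x -> f x = 0) -> forall x, ideal_gen x -> f x = 0.
Proof.
move=> fP x; elim=> {x}.
- exact: fP.
- exact: rmorph0.
- by move=> x y _ fx _ fy; rewrite rmorphD /= fx fy addr0.
- by move=> a x _ fx; rewrite rmorphM /= fx mulr0.
- by move=> x a _ fx; rewrite rmorphM /= fx mul0r.
Qed.

End IdealQuotient.

Lemma rmorph_braid (A B : pzRingType) (f : {rmorphism A -> B}) x y :
  f (x * y * x - y * x * y) = f x * f y * f x - f y * f x * f y.
Proof. by rewrite rmorphB !rmorphM. Qed.

Lemma rmorph_commutator (A B : pzRingType) (f : {rmorphism A -> B}) x y :
  f (x * y - y * x) = f x * f y - f y * f x.
Proof. by rewrite rmorphB !rmorphM. Qed.

Section Hecke.
Variables (F : fieldType) (q : F) (N : nat).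

Local Notation X := (@free_gen F 'I_N.-1).

(* The ordinal i of 'I_N.-1 indexes the generator R_(i + 1). *)
Inductive hecke_relator : free_alg F 'I_N.-1 -> Prop :=
| hecke_relator2 (i : 'I_N.-1) :
    hecke_relator (X i * X i - (1 + (q - q^-1) *: X i))
| hecke_relator3 (i j : 'I_N.-1) : (`|i - j| = 1)%N ->
    hecke_relator (X i * X j * X i - X j * X i * X j)
| hecke_relatorC (i j : 'I_N.-1) : (2 <= `|i - j|)%N ->
    hecke_relator (X i * X j - X j * X i).

Lemma hecke_relator_eval (B : algType F) (r : 'I_N.-1 -> B) :
  (forall i, r i * r i = 1 + (q - q^-1) *: r i) ->
  (forall i j : 'I_N.-1, (`|i - j| = 1)%N ->
    r i * r j * r i = r j * r i * r j) ->
  (forall i j : 'I_N.-1, (2 <= `|i - j|)%N -> r i * r j = r j * r i) ->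
  forall x, hecke_relator x -> free_eval r x = 0.
Proof.
move=> r2 r3 rC x [i|i j ij|i j ij].
- rewrite rmorphB rmorphD rmorphM rmorph1 /= free_eval_scalable !free_eval_gen.
  by rewrite r2 subrr.
- by rewrite rmorph_braid /= !free_eval_gen r3 // subrr.
- by rewrite rmorph_commutator /= !free_eval_gen rC // subrr.
Qed.

Definition hecke : Type := ideal_quot hecke_relator.

HB.instance Definition _ := GRing.Lmodule.on hecke.
HB.instance Definition _ := GRing.PzRing.on hecke.

Definition hecke_pi (x : free_alg F 'I_N.-1) : hecke := \pi x.
Definition hecke_gen (i : 'I_N.-1) : hecke := hecke_pi (X i).

Lemma hecke1_neq0 : (1 : hecke) != 0.
Proof.
apply/negP => /iq_piP; rewrite subr0 => one_in.
pose a : F^o := if q == 0 then 1 else q.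
have a2 : a * a = 1 + (q - q^-1) *: a.
  rewrite /a; case: eqVneq => [->|q0].
    by rewrite invr0 subrr scale0r addr0 mulr1.
  by rewrite /GRing.scale /= mulrBl mulVf // addrCA subrr addr0.
suff /(_ 1 one_in) : forall x, ideal_gen hecke_relator x ->
    free_eval (fun=> a) x = 0.
  by rewrite rmorph1 => /eqP; rewrite oner_eq0.
by apply/ideal_gen_ker/hecke_relator_eval.
Qed.

HB.instance Definition _ := GRing.PzSemiRing_isNonZero.Build hecke hecke1_neq0.
HB.instance Definition _ :=
  GRing.Lmodule_isLalgebra.Build F hecke (@iq_scalerAl _ _ hecke_relator).
HB.instance Definition _ :=
  GRing.Lalgebra_isAlgebra.Build F hecke (@iq_scalerAr _ _ hecke_relator).

HB.instance Definition _ :=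
  GRing.isZmodMorphism.Build (free_alg F 'I_N.-1) hecke hecke_pi
    (@iq_pi_zmod _ _ hecke_relator).
HB.instance Definition _ :=
  GRing.isMonoidMorphism.Build (free_alg F 'I_N.-1) hecke hecke_pi
    (@iq_pi_monoid _ _ hecke_relator).
HB.instance Definition _ :=
  GRing.isScalable.Build F (free_alg F 'I_N.-1) hecke *:%R hecke_pi
    (@iq_pi_scalable _ _ hecke_relator).

Lemma hecke_pi0 x : hecke_relator x -> hecke_pi x = 0.
Proof. by move=> x_rel; apply: iq_pi_eq; rewrite subr0; apply: ideal_gen_in. Qed.

Lemma hecke_gen2 i :
  hecke_gen i * hecke_gen i = 1 + (q - q^-1) *: hecke_gen i.
Proof.
have := hecke_pi0 (hecke_relator2 i).
rewrite rmorphB rmorphD rmorphM rmorph1 /=.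
rewrite [hecke_pi (_ *: _)](@iq_pi_scalable _ _ hecke_relator).
by move/eqP; rewrite subr_eq0 => /eqP.
Qed.

Lemma hecke_gen3 (i j : 'I_N.-1) : (`|i - j| = 1)%N ->
  hecke_gen i * hecke_gen j * hecke_gen i =
  hecke_gen j * hecke_gen i * hecke_gen j.
Proof.
move/hecke_relator3/hecke_pi0; rewrite rmorph_braid /=.
by move/eqP; rewrite subr_eq0 => /eqP.
Qed.

Lemma hecke_genC (i j : 'I_N.-1) : (2 <= `|i - j|)%N ->
  hecke_gen i * hecke_gen j = hecke_gen j * hecke_gen i.
Proof.
move/hecke_relatorC/hecke_pi0; rewrite rmorph_commutator /=.
by move/eqP; rewrite subr_eq0 => /eqP.
Qed.

Section Lift.
Variables (A : algType F) (r : 'I_N.-1 -> A).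
Hypothesis rP : forall x, hecke_relator x -> free_eval r x = 0.

(* The morphism sending each generator of index i to r i.  The proof argument
   makes it well defined, and makes the morphism instances below inferable. *)
Definition hecke_lift of (forall x, hecke_relator x -> free_eval r x = 0) :=
  fun u : hecke => free_eval r (repr u).

Local Notation lift := (hecke_lift rP).

Lemma hecke_lift_pi x : lift (hecke_pi x) = free_eval r x.
Proof.
apply/eqP; rewrite -subr_eq0 -rmorphB; apply/eqP.
exact: (ideal_gen_ker rP (iq_reprB _ x)).
Qed.

Lemma hecke_ind (K : hecke -> Prop) :
  (forall x, K (hecke_pi x)) -> forall u, K u.
Proof. exact: iq_ind. Qed.

Lemma hecke_lift_zmod : zmod_morphism lift.
Proof.
elim/hecke_ind=> x; elim/hecke_ind=> y.
by rewrite -rmorphB !hecke_lift_pi rmorphB.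
Qed.
Lemma hecke_lift_monoid : monoid_morphism lift.
Proof.
split; first by rewrite -(rmorph1 hecke_pi) hecke_lift_pi rmorph1.
elim/hecke_ind=> x; elim/hecke_ind=> y.
by rewrite -rmorphM !hecke_lift_pi rmorphM.
Qed.
Lemma hecke_lift_scalable : scalable lift.
Proof.
move=> c; elim/hecke_ind=> x; rewrite -[c *: _](iq_pi_scalable _ c x).
by rewrite [LHS]hecke_lift_pi hecke_lift_pi free_eval_scalable.
Qed.

HB.instance Definition _ :=
  GRing.isZmodMorphism.Build hecke A lift hecke_lift_zmod.
HB.instance Definition _ :=
  GRing.isMonoidMorphism.Build hecke A lift hecke_lift_monoid.
HB.instance Definition _ :=
  GRing.isScalable.Build F hecke A *:%R lift hecke_lift_scalable.

Lemma hecke_lift_gen i : lift (hecke_gen i) = r i.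
Proof. by rewrite hecke_lift_pi free_eval_gen. Qed.

End Lift.
End Hecke.

Arguments hecke_gen {F} q {N} i.

Section HeckeMaps.
Variables (F : fieldType) (q : F) (N : nat).

Definition widen_gen (i : 'I_N.-1) : 'I_N := widen_ord (leq_pred N) i.

Lemma shift_gen_subproof (i : 'I_N.-1) : (i.+1 < N)%N.
Proof. by rewrite -ltn_predRL. Qed.

Definition shift_gen (i : 'I_N.-1) : 'I_N := Ordinal (shift_gen_subproof i).

Lemma hecke_map_subproof (f : 'I_N.-1 -> 'I_N) :
  (forall i j, `|f i - f j| = `|i - j|)%N ->
  forall x, hecke_relator q x ->
    free_eval (fun i => hecke_gen q (N := N.+1) (f i)) x = 0.
Proof.
move=> fP; apply: hecke_relator_eval => [i|i j ij|i j ij].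
- exact: hecke_gen2.
- by apply: hecke_gen3; rewrite fP.
- by apply: hecke_genC; rewrite fP.
Qed.

Lemma widen_genP i j : (`|widen_gen i - widen_gen j| = `|i - j|)%N.
Proof. by []. Qed.

Lemma shift_genP i j : (`|shift_gen i - shift_gen j| = `|i - j|)%N.
Proof. by rewrite /= -addn1 -[j.+1]addn1 distnDr. Qed.

(* The algebra homomorphism H_N(q) -> H_(N + 1)(q), R_k |-> R_k. *)
Definition hecke_incl : hecke q N -> hecke q N.+1 :=
  hecke_lift (hecke_map_subproof widen_genP).

(* The algebra homomorphism H_N(q) -> H_(N + 1)(q), R_k |-> R_(k + 1). *)
Definition hecke_shift : hecke q N -> hecke q N.+1 :=
  hecke_lift (hecke_map_subproof shift_genP).

HB.instance Definition _ := GRing.LRMorphism.on hecke_incl.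
HB.instance Definition _ := GRing.LRMorphism.on hecke_shift.

Lemma hecke_incl_gen i :
  hecke_incl (hecke_gen q i) = hecke_gen q (N := N.+1) (widen_gen i).
Proof. exact: hecke_lift_gen. Qed.

Lemma hecke_shift_gen i :
  hecke_shift (hecke_gen q i) = hecke_gen q (N := N.+1) (shift_gen i).
Proof. exact: hecke_lift_gen. Qed.

End HeckeMaps.

(* The q-number [k]. *)
Definition qint (F : fieldType) (q : F) (k : int) : F :=
  (q ^ k - q ^ (- k)) / (q - q^-1).

(* From P_N to P_(N + 1).  For N = M + 1, ord_max : 'I_M.+1 indexes the last
   generator R_N of H_(N + 1)(q). *)
Definition antisymmetrizer_step (F : fieldType) (q : F) (N : nat) :
    hecke q N -> hecke q N.+1 :=
  match N return hecke q N -> hecke q N.+1 with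
  | 0 => fun=> 1
  | M.+1 => fun PN =>
      (qint q M.+2)^-1 *:
        (hecke_incl PN
         * ((q ^+ M.+1)%:A - qint q M.+1 *: @hecke_gen F q M.+2 ord_max)
         * hecke_incl PN)
  end.

(* P_N for N >= 1; the value at N = 0 is a dummy. *)
Fixpoint antisymmetrizer (F : fieldType) (q : F) (N : nat) : hecke q N :=
  match N return hecke q N with
  | 0 => 1
  | M.+1 => antisymmetrizer_step (antisymmetrizer q M)
  end.

(* The field C(q) of rational functions and its indeterminate. *)
Definition ratfunC (R : realType) : fieldType := {fraction {poly R[i]}}.
Definition ratfunC_q (R : realType) : ratfunC R := tofrac 'X.

(* Main.v *)
(* P_N is the idempotent that each of its generators multiplies, on either side,
   by -q^-1; these properties characterize it, so building it from the
   generators in reverse order gives the same element.  The recursion for P'_N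
   around the shift of P_(N - 1), which P_N absorbs, turns P_N P'_N P_N into a
   combination of P_N and P_N R_N P_N, so that
     [N]^2 P_N P'_N P_N = P_N + [N - 1][N + 1] P_(N + 1).
   Reversing the order of the generators exchanges P_N and P'_N and fixes
   P_(N + 1).  Subtracting the two identities gives the theorem, as idempotents
   x and y satisfy (x - y)^3 = x - y - (x y x - y x y). *)
From HB Require Import structures.
Require Import Defs.
From mathcomp Require Import all_boot all_order all_algebra.
From mathcomp Require Import reals.
From mathcomp Require Import ring.
From mathcomp Require Import zify.

Import GRing.Theory.
Local Open Scope ring_scope.

(* The defining relations are invariant under reversal of products, so left
   absorption in the converse algebra is right absorption in A. *)
Section ConverseAlgebra.
Variables (F : fieldType) (A : algType F).

HB.instance Definition _ := GRing.Zmodule_isLmodule.Build F (GRing.converse A)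
  (@scalerA F A) (@scale1r F A) (@scalerDr F A) (@scalerDl F A).

Lemma converse_scalerAl (c : F) (x y : GRing.converse A) :
  c *: (x * y) = c *: x * y.
Proof. exact: (@scalerAr F A c y x). Qed.
HB.instance Definition _ :=
  GRing.Lmodule_isLalgebra.Build F (GRing.converse A) converse_scalerAl.

Lemma converse_scalerAr (c : F) (x y : GRing.converse A) :
  c *: (x * y) = x * (c *: y).
Proof. exact: (@scalerAl F A c y x). Qed.
HB.instance Definition _ :=
  GRing.Lalgebra_isAlgebra.Build F (GRing.converse A) converse_scalerAr.

End ConverseAlgebra.

(** Multiplying the expanded (x - y)^2 on the right by x or by y cancels the products of length two,
    leaving x - x y x and y - y x y. *)
Lemma idempotent_sub_cube {A : pzRingType} {x y : A} :
  x * x = x -> y * y = y ->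
  (x - y) ^+ 3 = x - y - (x * y * x - y * x * y).
Proof.
move=> xx yy.
have cancel_mid (a b c : A) : a - b - (c - b) = a - c.
  by rewrite opprB addrA subrK.
have x2 : (x - y) * (x - y) = x - y * x - (x * y - y).
  by rewrite mulrBr !mulrBl xx yy.
have mul_x : (x - y * x - (x * y - y)) * x = x - x * y * x.
  by rewrite !mulrBl -!mulrA xx cancel_mid.
have mul_y : (x - y * x - (x * y - y)) * y = y - y * x * y.
  by rewrite !mulrBl -!mulrA yy opprB [LHS]addrC addrA subrK.
by rewrite exprSr expr2 x2 mulrBr mul_x mul_y !opprD addrACA.
Qed.

Section Asym.
Variables (F : fieldType) (q : F).
Hypothesis q_neq0 : q != 0.
Hypothesis qint_neq0 : forall n : nat, qint q n.+1 != 0.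

(** * Identities between q-numbers *)

Lemma qint_den_neq0 : q - q^-1 != 0.
Proof.
(* If the denominator were 0, its inverse and hence [1] would be 0. *)
have := qint_neq0 0; rewrite /qint; apply: contraNneq => ->.
by rewrite invr0 mulr0.
Qed.

Lemma qint0 : qint q 0 = 0.
Proof. by rewrite /qint oppr0 subrr mul0r. Qed.

Lemma qint1 : qint q 1 = 1.
Proof. by rewrite /qint divff // qint_den_neq0. Qed.

Lemma qintS (n : nat) : qint q n.+1 = q ^+ n + q^-1 * qint q n.
Proof.
have D := qint_den_neq0.
have Q : q ^+ n != 0 by rewrite expf_neq0.
apply: (mulIf D); rewrite /qint divfK // [RHS]mulrDl -mulrA divfK //.
rewrite -!exprnP -!exprnN exprS.
by field; rewrite q_neq0 Q.
Qed.

(** By [qintS] the left side does not depend on [n]. *)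
Lemma qint_cross (n : nat) : q ^+ n * qint q n.+1 - q ^+ n.+1 * qint q n = 1.
Proof.
elim: n => [|n IH]; first by rewrite qint0 qint1 mulr0 subr0 mulr1.
rewrite -[RHS]IH (qintS n.+1) (qintS n) !exprS; field; exact: q_neq0.
Qed.

(** The source of the constant in the theorem: 1 - 1/[N]^2 = [N - 1][N + 1]/[N]^2. *)
Lemma qint_sqr (n : nat) :
  qint q n.+1 ^+ 2 - qint q n * qint q n.+2 = 1.
Proof.
rewrite -[RHS](qint_cross n) (qintS n.+1) (qintS n) !exprS.
by field; exact: q_neq0.
Qed.

(* P_(n + 1) evaluated at the generators r 0, ..., r (n - 1): the index is one
   less than in the paper. *)
Fixpoint asym {A : algType F} (r : nat -> A) (n : nat) : A :=
  if n is m.+1 then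
    (qint q m.+2)^-1 *:
      (asym r m * ((q ^+ m.+1)%:A - qint q m.+1 *: r m) * asym r m)
  else 1.

(** With families indexed by [nat] in one algebra, P_N and P'_N are both values of [asym], and shift
    and reversal are mere reindexings. *)
Definition hecke_family {A : algType F} (r : nat -> A) (n : nat) :=
  [/\ forall i, (i < n)%N -> r i * r i = 1 + (q - q^-1) *: r i,
      forall i, (i.+1 < n)%N -> r i * r i.+1 * r i = r i.+1 * r i * r i.+1
    & forall i j, (i.+1 < j < n)%N -> r i * r j = r j * r i].

(** The recursion is a palindrome. *)
Lemma asym_converse (A : algType F) (r : nat -> A) n :
  asym (A := GRing.converse A) r n = asym r n.
Proof. by elim: n => //= n ->; congr (_ *: _); exact: (@mulrA A). Qed.

Lemma eq_asym (A : algType F) (r r' : nat -> A) n :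
  (forall i, (i < n)%N -> r i = r' i) -> asym r n = asym r' n.
Proof.
elim: n => //= n IH e; rewrite e // IH // => i lt_in.
by apply: e; apply: ltnW.
Qed.

(** * Symmetries of the Hecke relations *)

Lemma hecke_family_le {A : algType F} {r : nat -> A} {n} m :
  (m <= n)%N -> hecke_family r n -> hecke_family r m.
Proof.
move=> le_mn [r2 r3 rC]; split=> [i lt|i lt|i j /andP[lt_ij lt_jm]].
- by apply: r2; apply: leq_trans le_mn.
- by apply: r3; apply: leq_trans le_mn.
- by apply: rC; rewrite lt_ij (leq_trans lt_jm).
Qed.

Lemma hecke_family_shift {A : algType F} {r : nat -> A} {n} :
  hecke_family r n.+1 -> hecke_family (fun i => r i.+1) n.
Proof.
case=> r2 r3 rC; split=> [i|i|i j] lt; [exact: r2 | exact: r3 | exact: rC].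
Qed.

Lemma hecke_family_rev {A : algType F} {r : nat -> A} {n} :
  hecke_family r n -> hecke_family (fun i => r (n - i.+1)%N) n.
Proof.
case=> r2 r3 rC; split=> [i lt|i lt|i j lt].
- by apply: r2; lia.
- have -> : (n - i.+1 = (n - i.+2).+1)%N by lia.
  by rewrite r3 //; lia.
- by apply/esym/rC; lia.
Qed.

Lemma hecke_family_converse {A : algType F} {r : nat -> A} {n} :
  hecke_family r n -> hecke_family (A := GRing.converse A) r n.
Proof.
case=> r2 r3 rC; split=> [i|i lt|i j lt]; first exact: r2.
- by move: (r3 i lt); rewrite -!(@mulrA A) => e; exact: e.
- exact/esym/rC.
Qed.

(** * Absorption of generators and idempotency *)

Lemma comm_asym {A : algType F} {r : nat -> A} {n} (x : A) :
  (forall i, (i < n)%N -> r i * x = x * r i) -> asym r n * x = x * asym r n.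
Proof.
elim: n => [|n IH] rx /=; first by rewrite mul1r mulr1.
have ax : asym r n * x = x * asym r n.
  by apply: IH => i lt; apply: rx; apply: ltnW.
rewrite -scalerAl -scalerAr -!mulrA ax !mulrA; congr (_ *: (_ * _)).
rewrite -ax -!mulrA; congr (_ * _).
by rewrite mulrBl mulrBr mulr_algl mulr_algr -scalerAl -scalerAr rx.
Qed.

(** On [x] the middle factor acts as q^(m + 1) + q^-1 [m + 1] = [m + 2], which the normalization
    cancels. *)
Lemma asym_mul_absorb {A : algType F} {r : nat -> A} {n} (x : A) :
  (forall i, (i < n)%N -> r i * x = - q^-1 *: x) -> asym r n * x = x.
Proof.
elim: n => [|n IH] rx /=; first by rewrite mul1r.
have ax : asym r n * x = x.
  by apply: IH => i lt; apply: rx; apply: ltnW.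
rewrite -scalerAl -!mulrA ax mulrBl mulr_algl -scalerAl rx // scalerA -scalerBl.
rewrite -scalerAr ax scalerA -[RHS]scale1r; congr (_ *: _).
rewrite mulrN opprK (mulrC _ q^-1) -qintS // mulVf //.
Qed.

Lemma asymS {A : algType F} (r : nat -> A) n : asym r n * asym r n = asym r n ->
  qint q n.+2 *: asym r n.+1
  = q ^+ n.+1 *: asym r n - qint q n.+1 *: (asym r n * r n * asym r n).
Proof.
move=> idem; rewrite /= scalerA mulfV // scale1r mulrBr mulrBl mulr_algr.
by rewrite -scalerAl idem -scalerAr -scalerAl.
Qed.

(* Used with p = P_(m + 1), P = P_(m + 2), s = R_(m + 1), t = R_(m + 2),
   c = q ^ (m + 1), k = [m + 1] and K = [m + 2]. *)
Lemma braid_absorb {A : algType F} (P p s t : A) (c k K : F) :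
  K *: P = c *: p - k *: (p * s * p) -> p * P = P -> p * t = t * p ->
  s * P = - q^-1 *: P -> t * t = 1 + (q - q^-1) *: t -> s * t * s = t * s * t ->
  t * ((q * c) *: P - K *: (P * t * P))
  = - q^-1 *: ((q * c) *: P - K *: (P * t * P)).
Proof.
move=> KP pP pt sP tt sts.
have KPtP : K *: (P * t * P) = c *: (t * P) - k *: (p * s * t * P).
  rewrite !scalerAl KP !mulrBl -!scalerAl pt -[t * p * P]mulrA pP.
  by rewrite -[p * s * p * t]mulrA pt mulrA -[_ * p * P]mulrA pP.
have KtPtP : K *: (t * (P * t * P)) =
    c *: P + (c * (q - q^-1)) *: (t * P) + (q^-1 * k) *: (p * s * t * P).
  rewrite scalerAr KPtP mulrBr -!scalerAr.
  rewrite !mulrA tt mulrDl mul1r scalerDr -scalerAl scalerA; congr (_ + _).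
  (* Moving [t] past [p] forms the braid word t s t; once it is turned into s t s, [P] absorbs the
     last [s]. *)
  have -> : t * p * s * t * P = p * s * t * s * P.
    by rewrite -pt -!mulrA [t * (s * _)]mulrA [t * s * _]mulrA -sts !mulrA.
  by rewrite -mulrA sP -scalerAr scalerA -scaleNr mulrN opprK mulrC.
rewrite mulrBr -!scalerAr KtPtP KPtP.
(* Both sides are now combinations of [P], [u] and [v], compared coefficientwise. *)
set u := t * P; set v := p * s * t * P.
rewrite [RHS]scalerBr [- q^-1 *: (_ - _)]scalerBr !scalerA !mulNr.
rewrite [q^-1 * (q * c)]mulrA mulVf // mul1r !scaleNr opprB opprK.
rewrite !opprD !addrA (addrAC _ (- (c *: P))) -scalerBl.
rewrite [RHS]addrC !addrA; congr (_ *: _ - _ - _); ring.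
Qed.

(** The left factor [asym r n] absorbs all generators but the last, which [braid_absorb] handles.
    That lemma looks two levels down, hence the strong induction. *)
Lemma asym_absorbl {A : algType F} {r : nat -> A} {n} : hecke_family r n ->
  forall i, (i < n)%N -> r i * asym r n = - q^-1 *: asym r n.
Proof.
elim/ltn_ind: n => -[//|n] IH Hr i; rewrite ltnS leq_eqVlt.
have IHn := IH n (ltnSn n) (hecke_family_le n (leqnSn n) Hr).
case/orP=> [/eqP-> {i}|lt_in]; last first.
  by rewrite /= -scalerAr !mulrA IHn // -!scalerAl !scalerA mulrC.
have [r2 r3 rC] := Hr.
have idem := asym_mul_absorb _ IHn.
apply: (scalerI (qint_neq0 n.+1)).
rewrite scalerAr [RHS]scalerA mulrC -[RHS]scalerA asymS //.
(* For a single generator the quadratic relation suffices. *)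
case: n => [|n] in IH Hr IHn r2 r3 rC idem *.
  rewrite /= qint1 // scale1r mulr1 mul1r mulrBr -scalerAr mulr1 r2 //.
  rewrite expr1 scalerBr scalerA mulNr mulVf // scaleN1r scaleNr opprK.
  by rewrite scalerBl opprD opprB addrCA [_ + (_ - _)]addrC subrK.
have pp : asym r n * asym r n = asym r n.
  apply/asym_mul_absorb/IH; first exact: ltnW.
  by apply: hecke_family_le Hr; rewrite -addn2 leq_addr.
rewrite (exprS q n.+1); apply: braid_absorb (asymS r n pp) _ _ _ _ _.
- by apply: asym_mul_absorb => i lt; apply: IHn; apply: ltnW.
- by apply: comm_asym => i lt; apply: rC; rewrite ltnS lt /=.
- exact: IHn.
- exact: r2.
- exact: r3.
Qed.

Lemma asym_absorbr {A : algType F} {r : nat -> A} {n} : hecke_family r n ->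
  forall i, (i < n)%N -> asym r n * r i = - q^-1 *: asym r n.
Proof.
move=> Hr i lt_in.
have := asym_absorbl (hecke_family_converse Hr) _ lt_in.
by rewrite asym_converse.
Qed.

Lemma asym_idem {A : algType F} {r : nat -> A} {n} : hecke_family r n ->
  asym r n * asym r n = asym r n.
Proof. by move=> Hr; apply/asym_mul_absorb/asym_absorbl. Qed.

(** * Reversal, the sandwich identity and the cube *)

Lemma mul_asym_absorb {A : algType F} {r : nat -> A} {n} (x : A) :
  (forall i, (i < n)%N -> x * r i = - q^-1 *: x) -> x * asym r n = x.
Proof.
move=> rx; rewrite -[asym r n]asym_converse.
exact: (@asym_mul_absorb (GRing.converse A)).
Qed.

(** Each side absorbs the generators of the other, so the product of the two equals both. *)
Lemma asym_rev {A : algType F} {r : nat -> A} {n} : hecke_family r n ->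
  asym (fun i => r (n - i.+1)%N) n = asym r n.
Proof.
move=> Hr; set r' := fun i => _.
rewrite -[LHS](mul_asym_absorb (r := r) (n := n)) => [|i lt_in].
  rewrite asym_mul_absorb // => i lt_in.
  by apply: (asym_absorbl Hr); lia.
have -> : r i = r' (n - i.+1)%N by congr r; lia.
by apply: asym_absorbr; [apply: hecke_family_rev | lia].
Qed.

Lemma asym_shift_sandwich {A : algType F} {r : nat -> A} {n} :
  hecke_family r n.+1 ->
  let P := asym r n in let P' := asym (fun i => r i.+1) n in
  qint q n.+1 ^+ 2 *: (P * P' * P) =
  P + (qint q n * qint q n.+2) *: asym r n.+1.
Proof.
move=> Hr P P'.
have HP : hecke_family r n by apply: hecke_family_le Hr.
have PP : P * P = P by apply: asym_idem.
(* For N = 1, P = P' = 1 and [0] = 0 removes the last term. *)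
case: n => [|n] in Hr P P' HP PP *.
  by rewrite qint0 qint1 // mul0r scale0r addr0 expr1n scale1r !mulr1.
(* Now N = n + 2, and [Q] is the shift of P_(N - 1), whose generators R_2, ..., R_(N - 1) all occur
   in [P]. *)
pose Q := asym (fun i => r i.+1) n.
have HQ : hecke_family (fun i => r i.+1) n := hecke_family_shift HP.
have PQ : P * Q = P.
  by apply: mul_asym_absorb => i lt; apply: asym_absorbr.
have QP : Q * P = P.
  by apply: asym_mul_absorb => i lt; apply: asym_absorbl.
have eP' := asymS (fun i => r i.+1) _ (asym_idem HQ).
have eE := asymS r _ PP.
set E := asym r n.+2 in eE *.
rewrite -/P -/P' -/Q in eP' eE; clearbody P P' Q E.
have -> : qint q n.+2 ^+ 2 *: (P * P' * P)
    = qint q n.+2 *: (P * (qint q n.+2 *: P') * P).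
  by rewrite expr2 -scalerA -scalerAr -scalerAl.
rewrite eP' -[in RHS]scalerA eE.
rewrite mulrBr mulrBl -!scalerAr -!scalerAl PQ PP.
rewrite !mulrA PQ -!mulrA QP mulrA.
rewrite !scalerBr !scalerA addrA -[X in _ = X + _ - _]scale1r -scalerDl.
rewrite (mulrC (qint q n.+2) (qint q n.+1)); congr (_ *: _ - _).
(* The coefficients of [P] agree: [N] q^(N - 1) = 1 + [N - 1] q^N. *)
rewrite -(qint_cross n.+1); ring.
Qed.

Lemma asym_difference_cube {A : algType F} {r : nat -> A} {n} :
  hecke_family r n.+1 ->
  let P := asym r n in let P' := asym (fun i => r i.+1) n in
  (P - P') ^+ 3 =
  (qint q n * qint q n.+2 / qint q n.+1 ^+ 2) *: (P - P').
Proof.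
move=> Hr P P'.
(* The reversal of all n + 1 generators, as n - i = (n + 1) - (i + 1). *)
pose r' i := r (n - i)%N.
have Hr' : hecke_family r' n.+1 := hecke_family_rev Hr.
have rP : asym (fun i => r' i.+1) n = P.
  exact/asym_rev/(hecke_family_le n (leqnSn n) Hr).
have rP' : asym r' n = P'.
  rewrite /P' -(asym_rev (hecke_family_shift Hr)); apply: eq_asym => i lt_in.
  by congr r; lia.
have PP : P * P = P by apply/asym_idem/(hecke_family_le n (leqnSn n) Hr).
have PP' : P' * P' = P' by apply/asym_idem/hecke_family_shift.
have cube := idempotent_sub_cube PP PP'.
have rE : asym r' n.+1 = asym r n.+1 := asym_rev Hr.
have := asym_shift_sandwich Hr'; cbv zeta; rewrite rP rP' rE => S'.
have := asym_shift_sandwich Hr; cbv zeta; rewrite -/P -/P' => S.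
have K0 : qint q n.+1 ^+ 2 != 0 by rewrite expf_neq0.
have D : qint q n.+1 ^+ 2 *: (P * P' * P - P' * P * P') = P - P'.
  by rewrite scalerBr S S' opprD addrACA subrr addr0.
clearbody P P'.
apply: (scalerI K0); rewrite cube scalerBr D -{2}[P - P']scale1r -scalerBl.
by rewrite scalerA mulrC divfK // -(qint_sqr n); congr (_ *: _); ring.
Qed.

End Asym.

Arguments asym {F} q {A} r n.
Arguments hecke_family {F} q {A} r n.

(** * Transfer to the presented Hecke algebra *)

Section Hecke.
Variables (F : fieldType) (q : F).

(** A general morphism [f] lets the induction compose it with the inclusion, and covers both P_N and
    P'_N. *)
Lemma antisymmetrizer_asym n (A : algType F) (r : nat -> A)
    (f : {lrmorphism hecke q n.+1 -> A}) :
  (forall i : 'I_n, f (hecke_gen q (N := n.+1) i) = r i) ->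
  f (antisymmetrizer q n.+1) = asym q r n.
Proof.
elim: n A r f => [|n IH] A r f fr; first exact: rmorph1.
have IHn : f (hecke_incl (antisymmetrizer q n.+1)) = asym q r n.
  apply: (IH A r (f \o @hecke_incl F q n.+1)) => i /=.
  by rewrite hecke_incl_gen fr.
have step : f (antisymmetrizer q n.+2) = (qint q n.+2)^-1 *:
    (f (hecke_incl (antisymmetrizer q n.+1))
     * f ((q ^+ n.+1)%:A - qint q n.+1 *: hecke_gen q (N := n.+2) ord_max)
     * f (hecke_incl (antisymmetrizer q n.+1))).
  by rewrite [LHS]linearZ !rmorphM.
have mid : f ((q ^+ n.+1)%:A - qint q n.+1 *: hecke_gen q (N := n.+2) ord_max)
    = (q ^+ n.+1)%:A - qint q n.+1 *: r n.
  rewrite [LHS]rmorphB; congr (_ - _); last by rewrite [LHS]linearZ /= fr.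
  by rewrite [LHS]linearZ /= rmorph1.
by rewrite step IHn mid.
Qed.

Lemma hecke_gen_family n :
  hecke_family q (fun i => hecke_gen q (N := n.+2) (inord i)) n.+1.
Proof.
split=> [i _|i lt|i j /andP[lt_ij lt]]; first exact: hecke_gen2.
- by apply: hecke_gen3; rewrite !inordK //; lia.
- by apply: hecke_genC; rewrite !inordK //; lia.
Qed.

Lemma antisymmetrizer_difference_cube n :
  q != 0 -> (forall m : nat, qint q m.+1 != 0) ->
  let P := hecke_incl (antisymmetrizer q n.+1) in
  let P' := hecke_shift (antisymmetrizer q n.+1) in
  (P - P') ^+ 3
  = (qint q n * qint q n.+2 / qint q n.+1 ^+ 2) *: (P - P').
Proof.
move=> q_neq0 qint_neq0 P P'.
(* [inord] makes the family total; only indices up to [n], where it is faithful, matter. *)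
pose r i := hecke_gen q (N := n.+2) (inord i).
have PE : P = asym q r n.
  apply: (antisymmetrizer_asym _ _ r (@hecke_incl _ q n.+1)) => i /=.
  rewrite hecke_incl_gen; congr hecke_gen; apply: val_inj => /=.
  by rewrite inordK // ltnW // ltnS; apply: (ltn_ord i).
have PE' : P' = asym q (fun i => r i.+1) n.
  apply: (antisymmetrizer_asym _ _ (fun i => r i.+1)
            (@hecke_shift _ q n.+1)) => i /=.
  rewrite hecke_shift_gen; congr hecke_gen; apply: val_inj => /=.
  by rewrite inordK // ltnS; apply: (ltn_ord i).
rewrite PE PE'.
exact: (asym_difference_cube _ _ q_neq0 qint_neq0 (hecke_gen_family n)).
Qed.

End Hecke.

(** * Nonvanishing of q-numbers over C(q) *)

Lemma qint_not_root_of_unity {F : fieldType} {q : F} : q != 0 ->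
  (forall n, q ^+ n.+1 != 1) -> forall n : nat, qint q n.+1 != 0.
Proof.
move=> q0 q_free n.
have pow_neq (m : nat) : q ^+ m.+1 - q ^- m.+1 != 0.
  (* If q^(m + 1) = q^-(m + 1), then q^(2m + 2) = 1. The case m = 0 also covers the denominator. *)
  apply: contra (q_free (m + m.+1)%N); rewrite subr_eq0 => /eqP e.
  by rewrite -addSn exprD {1}e mulVf // expf_neq0.
by rewrite /qint -exprnP -exprnN mulf_neq0 ?invr_neq0 ?pow_neq // (pow_neq 0).
Qed.

Section RationalFunctions.
Variable R : realType.

Lemma ratfunC_q_neq0 : ratfunC_q R != 0.
Proof. by rewrite /ratfunC_q tofrac_eq0 polyX_eq0. Qed.

Lemma ratfunC_q_free n : ratfunC_q R ^+ n.+1 != 1.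
Proof.
rewrite /ratfunC_q -tofracXn -tofrac1 tofrac_eq; apply/eqP.
by move/(congr1 (fun p : {poly _} => size p)); rewrite size_polyXn size_poly1.
Qed.

End RationalFunctions.

Theorem proposition1 (R : realType) (N : nat) (N_ge1 : (1 <= N)%N) :
  let q : ratfunC R := ratfunC_q R in
  let P : hecke q N.+1 := hecke_incl (antisymmetrizer q N) in
  let P' : hecke q N.+1 := hecke_shift (antisymmetrizer q N) in
  (P - P') ^+ 3
  = (qint q (N%:Z - 1) * qint q (N%:Z + 1) / qint q N%:Z ^+ 2) *: (P - P').
Proof.
case: N N_ge1 => // n _.
have -> : (n.+1%:Z - 1 = n)%R by lia.
have -> : (n.+1%:Z + 1 = n.+2)%R by lia.
have q_neq0 := ratfunC_q_neq0 R.
have qint_neq0 := qint_not_root_of_unity q_neq0 (@ratfunC_q_free R).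
exact (antisymmetrizer_difference_cube _ _ n q_neq0 qint_neq0).
Qed.
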